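(* For every real $z\ge\frac14$ and every $t\in\mathbb{R}$, $$\sum_{n=0}^\infty g_n(z)\frac{t^n}{n!}=\begin{cases} e^{\frac{t}{2\sqrt z}}\left(\cos\frac{t\sqrt{4z-1}}{2\sqrt z}+\frac{1}{\sqrt{4z-1}}\sin\frac{t\sqrt{4z-1}}{2\sqrt z}\right), & \text{if } z>\frac14,\\[2mm] (t+1)e^{t}, & \text{if } z=\frac14.\end{cases}$$
   Context: For each integer $n\ge 0$ and real $z>0$, $g_n(z)=\sum_{k=0}^{\lfloor n/2\rfloor}(-1)^k\binom{n-k}{k}z^{k-\frac n2}$. *)

(* Defs.v *)
From Stdlib Require Import Reals.
From Coquelicot Require Import Coquelicot.
Open Scope R_scope.

(* The exponent k - n/2 is a half-integer, hence the real power Rpower, which is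
   the usual power for z > 0.  Binomial.C is the real-valued binomial
   coefficient (the unqualified C is Coquelicot's complex numbers); it agrees
   with the combinatorial one here because k <= n - k on the summation range.
   sum_f_R0 f N includes both end points 0 and N, and (n / 2)%nat is the floor. *)
Definition g (n : nat) (z : R) : R :=
  sum_f_R0
    (fun k : nat =>
       (-1) ^ k * Binomial.C (n - k) k * Rpower z (INR k - INR n / 2))
    (n / 2)%nat.

(* Main.v *)
Require Import Defs.
From Stdlib Require Import Arith Reals Factorial Lra Lia.
From Coquelicot Require Import Coquelicot.
Open Scope R_scope.

(** Pascal's rule on the summands gives [g (n+2) = z^(-1/2) g (n+1) - g n], so the
    exponential generating function solves [y'' = z^(-1/2) y' - y] with
    [y 0 = 1] and [y' 0 = z^(-1/2)].  The closed forms solve the same initial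
    value problem, and uniqueness follows from a Gronwall estimate for the energy
    [y^2 + y'^2]. *)

(** * Three-term recurrence for [g] *)

(* [Binomial.C n k] is a nonzero junk value when [n < k]; with the value [0]
   there, Pascal's rule holds for all arguments and the sum defining [g] can be
   extended beyond [n / 2]. *)
Definition binom0 (n k : nat) : R :=
  if le_dec k n then Binomial.C n k else 0.

Lemma binom0_n_0 (n : nat) : binom0 n 0 = 1.
Proof.
unfold binom0; destruct (le_dec 0 n) as [_|H]; [apply C_n_0 | lia].
Qed.

Lemma binom0_gt (n k : nat) : (n < k)%nat -> binom0 n k = 0.
Proof.
intros H; unfold binom0; destruct (le_dec k n); [lia | reflexivity].
Qed.

Lemma binom0_pascal (n k : nat) :
  binom0 (S n) (S k) = binom0 n k + binom0 n (S k).
Proof.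
destruct (lt_eq_lt_dec k n) as [[H| -> ]|H].
- unfold binom0.
  destruct (le_dec (S k) (S n)); [|lia].
  destruct (le_dec k n); [|lia].
  destruct (le_dec (S k) n); [|lia].
  now rewrite pascal.
- rewrite (binom0_gt n (S n)) by lia.
  unfold binom0.
  destruct (le_dec (S n) (S n)); [|lia].
  destruct (le_dec n n); [|lia].
  rewrite !C_n_n; ring.
- rewrite !binom0_gt by lia; ring.
Qed.

Definition g_term (z : R) (n k : nat) : R :=
  (-1) ^ k * binom0 (n - k) k * Rpower z (INR k - INR n / 2).

Lemma sum_f_R0_extend (f : nat -> R) (m n : nat) :
  (m <= n)%nat -> (forall k, (m < k)%nat -> f k = 0) ->
  sum_f_R0 f n = sum_f_R0 f m.
Proof.
intros Hmn Hf; induction Hmn as [|n Hmn IH]; [reflexivity|].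
simpl; rewrite IH, Hf by lia; ring.
Qed.

(** For [k] beyond [n / 2] the truncated difference [n - k] is below [k], so [binom0] kills the
    term. This lets sums for different [n] share a range. *)
Lemma g_extend (n m : nat) (z : R) :
  (n / 2 <= m)%nat -> g n z = sum_f_R0 (g_term z n) m.
Proof.
intros Hm.
rewrite (sum_f_R0_extend (g_term z n) (n / 2) m Hm).
- apply sum_eq; intros k Hk; unfold g_term, binom0.
  destruct (le_dec k (n - k)) as [_|H]; [reflexivity|].
  pose proof (Nat.Div0.mul_div_le n 2); lia.
- intros k Hk; unfold g_term.
  rewrite binom0_gt; [ring|].
  pose proof (Nat.div_mod_eq n 2); pose proof (Nat.mod_upper_bound n 2); lia.
Qed.

Lemma Rpower_mhalf (z : R) : 0 < z -> Rpower z (- / 2) = / sqrt z.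
Proof. intros Hz; now rewrite Rpower_Ropp, Rpower_sqrt. Qed.

Lemma g_term_0_S (z : R) (n : nat) :
  0 < z -> g_term z (S n) 0 = / sqrt z * g_term z n 0.
Proof.
intros Hz; unfold g_term; rewrite !binom0_n_0, <- (Rpower_mhalf z Hz).
replace (INR 0 - INR (S n) / 2) with (- / 2 + (INR 0 - INR n / 2))
  by (rewrite S_INR; field).
rewrite Rpower_plus; ring.
Qed.

(** Pascal's rule splits the binomial over [n - k]; the extra sign in [(-1) ^ S k] turns one half
    into [- g_term z n k], and the other half differs from [g_term z (S n) (S k)] by a factor
    [z^(-1/2)]. The bound [k <= n] keeps the natural subtractions exact. *)
Lemma g_term_SS (z : R) (n k : nat) :
  0 < z -> (k <= n)%nat ->
  g_term z (S (S n)) (S k) = / sqrt z * g_term z (S n) (S k) - g_term z n k.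
Proof.
intros Hz Hk; unfold g_term; rewrite <- (Rpower_mhalf z Hz).
replace (S (S n) - S k)%nat with (S (n - k)) by lia.
replace (S n - S k)%nat with (n - k)%nat by lia.
rewrite binom0_pascal.
replace (INR (S k) - INR (S (S n)) / 2) with (INR k - INR n / 2)
  by (rewrite !S_INR; field).
replace (INR k - INR n / 2) with (- / 2 + (INR (S k) - INR (S n) / 2))
  by (rewrite !S_INR; field).
rewrite Rpower_plus; simpl; ring.
Qed.

Lemma g_0 (z : R) : 0 < z -> g 0 z = 1.
Proof.
intros Hz; rewrite (g_extend 0 0) by (simpl; lia).
simpl; unfold g_term; rewrite binom0_n_0; simpl.
replace (0 - 0 / 2) with 0 by field.
rewrite Rpower_O by assumption; ring.
Qed.

Lemma g_1 (z : R) : 0 < z -> g 1 z = / sqrt z.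
Proof.
intros Hz; rewrite (g_extend 1 0) by (simpl; lia).
simpl sum_f_R0; rewrite g_term_0_S by assumption.
pose proof (g_0 z Hz) as H; rewrite (g_extend 0 0) in H by (simpl; lia).
simpl sum_f_R0 in H; rewrite H; ring.
Qed.

Lemma g_SS (z : R) (n : nat) :
  0 < z -> g (S (S n)) z = / sqrt z * g (S n) z - g n z.
Proof.
intros Hz.
assert (Hdiv : forall m, (2 * (m / 2) <= m)%nat)
  by (intros m; apply Nat.Div0.mul_div_le).
(* With upper ends [S n], [S n] and [n], all three sums run up to [n] once the index 0 is split off
   the first two. *)
rewrite (g_extend (S (S n)) (S n)) by (specialize (Hdiv (S (S n))); lia).
rewrite (g_extend (S n) (S n)) by (specialize (Hdiv (S n)); lia).
rewrite (g_extend n n) by (specialize (Hdiv n); lia).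
rewrite !(decomp_sum _ (S n)) by lia; simpl pred.
rewrite g_term_0_S by assumption.
rewrite (sum_eq _ (fun k => g_term z (S n) (S k) * / sqrt z - g_term z n k))
  by (intros k Hk; rewrite g_term_SS by assumption; ring).
rewrite minus_sum, <- scal_sum; ring.
Qed.

(** * Convergence of exponential generating functions *)

Definition egf_coef (u : nat -> R) (n : nat) : R := u n / INR (fact n).

(** Factorials beat geometric growth: [(K * Rabs r) ^ n / n!] tends to 0, hence is bounded, so every
    real [r] is at most the radius. *)
Lemma CV_radius_egf (u : nat -> R) (M K : R) :
  0 <= K -> (forall n, Rabs (u n) <= M * K ^ n) ->
  CV_radius (egf_coef u) = p_infty.
Proof.
intros HK Hu.
assert (HM : 0 <= M).
{ generalize (Hu 0%nat) (Rabs_pos (u 0%nat)); simpl; lra. }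
assert (Hr : forall r : R, Rbar_le r (CV_radius (egf_coef u))).
{ intros r; apply (proj1 (CV_radius_bounded (egf_coef u))).
  destruct (maj_by_pos _ (exist _ 0 (cv_speed_pow_fact (K * Rabs r))))
    as [B [_ HB]].
  exists (M * B); intros n.
  unfold egf_coef, Rdiv; rewrite !Rabs_mult, Rabs_inv.
  rewrite <- RPow_abs.
  rewrite (Rabs_pos_eq (INR (fact n))) by apply pos_INR.
  apply Rle_trans with (M * ((K * Rabs r) ^ n / INR (fact n))).
  - rewrite Rpow_mult_distr; unfold Rdiv.
    replace (M * (K ^ n * Rabs r ^ n * / INR (fact n)))
      with (M * K ^ n * / INR (fact n) * Rabs r ^ n) by ring.
    apply Rmult_le_compat_r; [apply pow_le, Rabs_pos|].
    apply Rmult_le_compat_r; [|apply Hu].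
    left; apply Rinv_0_lt_compat, INR_fact_lt_0.
  - apply Rmult_le_compat_l; [exact HM|].
    apply Rle_trans with (1 := Rle_abs _), HB. }
destruct (CV_radius (egf_coef u)) as [c| |]; [|reflexivity|].
- specialize (Hr (c + 1)); simpl in Hr; lra.
- specialize (Hr 0); simpl in Hr; contradiction.
Qed.

(** Induction on two consecutive terms. The summand 1 in the base makes its powers nondecreasing, so
    both earlier terms are bounded by the same power. *)
Lemma linear_recurrence_growth (p q : R) (u : nat -> R) (n : nat) :
  (forall n, u (S (S n)) = p * u (S n) + q * u n) ->
  Rabs (u n) <= (Rabs (u 0%nat) + Rabs (u 1%nat)) * (1 + Rabs p + Rabs q) ^ n.
Proof.
intros Hu.
set (M := Rabs (u 0%nat) + Rabs (u 1%nat)); set (K := 1 + Rabs p + Rabs q).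
pose proof (Rabs_pos p); pose proof (Rabs_pos q).
pose proof (Rabs_pos (u 0%nat)); pose proof (Rabs_pos (u 1%nat)).
assert (HK : 1 <= K) by (unfold K; lra).
enough (H' : Rabs (u n) <= M * K ^ n /\ Rabs (u (S n)) <= M * K ^ S n)
  by apply H'.
induction n as [|n [IH0 IH1]].
- simpl; unfold M; split; nra.
- split; [exact IH1|].
  assert (Hn : Rabs (u n) <= M * K ^ S n).
  { apply Rle_trans with (1 := IH0), Rmult_le_compat_l; [unfold M; lra|].
    apply Rle_pow; [exact HK|lia]. }
  rewrite Hu; apply Rle_trans with (1 := Rabs_triang _ _).
  rewrite !Rabs_mult.
  apply Rle_trans with (Rabs p * (M * K ^ S n) + Rabs q * (M * K ^ S n)).
  + apply Rplus_le_compat; now apply Rmult_le_compat_l.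
  + assert (0 <= M * K ^ S n) by (apply Rle_trans with (2 := IH1), Rabs_pos).
    change (K ^ S (S n)) with (K * K ^ S n); unfold K at 3; nra.
Qed.

(** * Uniqueness for the second-order linear equation *)

Lemma linear_ode_zero (p q : R) (y v : R -> R) (t : R) :
  (forall x, is_derive y x (v x)) ->
  (forall x, is_derive v x (p * v x + q * y x)) ->
  y 0 = 0 -> v 0 = 0 -> y t = 0.
Proof.
intros Hy Hv Hy0 Hv0.
(* The energy has derivative [2(1+q)yv + 2pv^2]; [2|yv| <= y^2 + v^2] and [v^2 <= y^2 + v^2] give
   this constant. *)
set (K := Rabs (1 + q) + 2 * Rabs p).
(* The sign of [c] makes the weighted energy decrease from [0] towards [t]. *)
set (c := if Rle_dec 0 t then K else - K).
set (phi := fun x => exp (- c * x) * (y x ^ 2 + v x ^ 2)).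
set (dE := fun x => 2 * (1 + q) * (y x * v x) + 2 * p * v x ^ 2).
assert (Hphi : forall x, is_derive phi x
          (exp (- c * x) * (dE x - c * (y x ^ 2 + v x ^ 2)))).
{ intros x; unfold phi, dE.
  pose proof (is_derive_unique _ _ _ (Hy x)) as Ey.
  pose proof (is_derive_unique _ _ _ (Hv x)) as Ev.
  auto_derive.
  - split; [now exists (v x)|split; [|exact I]].
    now exists (p * v x + q * y x).
  - replace (Derive (fun x0 : R => y x0) x) with (v x) by (symmetry; exact Ey).
    replace (Derive (fun x0 : R => v x0) x) with (p * v x + q * y x)
      by (symmetry; exact Ev).
    ring. }
assert (HE : forall x, Rabs (dE x) <= K * (y x ^ 2 + v x ^ 2)).
{ intros x; unfold dE, K.
  assert (Hyv : 2 * Rabs (y x * v x) <= y x ^ 2 + v x ^ 2).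
  { rewrite Rabs_mult, <- (pow2_abs (y x)), <- (pow2_abs (v x)).
    pose proof (pow2_ge_0 (Rabs (y x) - Rabs (v x))); nra. }
  apply Rle_trans with (1 := Rabs_triang _ _).
  rewrite !Rabs_mult, (Rabs_pos_eq 2), (Rabs_pos_eq (v x ^ 2))
    by (try apply pow2_ge_0; lra).
  rewrite <- Rabs_mult.
  pose proof (Rabs_pos (1 + q)); pose proof (Rabs_pos p).
  pose proof (pow2_ge_0 (y x)); nra. }
(* As [phi 0 = 0], this gives [phi t] as the derivative at [xi] times [t], a product that is
   nonpositive for either sign of [t]. *)
destruct (MVT_gen phi 0 t _ (fun x _ => Hphi x)) as [xi [_ Hxi]].
{ intros x _; apply continuity_pt_filterlim.
  apply (ex_derive_continuous phi); eexists; apply Hphi. }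
assert (Hdec : (dE xi - c * (y xi ^ 2 + v xi ^ 2)) * t <= 0).
{ specialize (HE xi); apply Rabs_le_between in HE; unfold c.
  destruct (Rle_dec 0 t); nra. }
assert (Hphi0 : phi 0 = 0) by (unfold phi; rewrite Hy0, Hv0; ring).
assert (Hphit : phi t <= 0).
{ pose proof (exp_pos (- c * xi)); nra. }
unfold phi in Hphit.
pose proof (exp_pos (- c * t)); pose proof (pow2_ge_0 (v t)).
assert (y t ^ 2 <= 0) by nra.
nra.
Qed.

(** * Generating functions of linear recurrences *)

Lemma PS_derive_egf (u : nat -> R) (n : nat) :
  PS_derive (egf_coef u) n = egf_coef (fun m => u (S m)) n.
Proof.
unfold PS_derive, egf_coef; rewrite fact_simpl, mult_INR; field.
split; [apply INR_fact_neq_0|now apply not_0_INR].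
Qed.

(** Differentiation shifts [u], so the recurrence becomes the differential equation of [F]; the
    power series minus [F] then has zero initial data. *)
Lemma is_series_egf (p q : R) (u : nat -> R) (F dF : R -> R) (t : R) :
  (forall n, u (S (S n)) = p * u (S n) + q * u n) ->
  (forall x, is_derive F x (dF x)) ->
  (forall x, is_derive dF x (p * dF x + q * F x)) ->
  F 0 = u 0%nat -> dF 0 = u 1%nat ->
  is_series (fun n => u n * (t ^ n / INR (fact n))) (F t).
Proof.
intros Hu HF HdF HF0 HdF0.
set (u1 := fun n => u (S n)); set (u2 := fun n => u1 (S n)).
(* Stated for any solution [w] of the recurrence, to serve both [u] and its shift [u1]. *)
assert (Hrad : forall w, (forall n, w (S (S n)) = p * w (S n) + q * w n) ->
          CV_radius (egf_coef w) = p_infty).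
{ intros w Hw; apply (CV_radius_egf w (Rabs (w 0%nat) + Rabs (w 1%nat))
                        (1 + Rabs p + Rabs q)).
  - pose proof (Rabs_pos p); pose proof (Rabs_pos q); lra.
  - intros n; now apply linear_recurrence_growth. }
assert (Hder : forall w x, (forall n, w (S (S n)) = p * w (S n) + q * w n) ->
          is_derive (PSeries (egf_coef w)) x
            (PSeries (egf_coef (fun n => w (S n))) x)).
{ intros w x Hw.
  rewrite <- (PSeries_ext _ _ x (PS_derive_egf w)).
  apply is_derive_PSeries; now rewrite Hrad. }
assert (Hex : forall w x, (forall n, w (S (S n)) = p * w (S n) + q * w n) ->
          ex_pseries (egf_coef w) x).
{ intros w x Hw; apply CV_radius_inside; now rewrite Hrad. }
assert (Hu1 : forall n, u1 (S (S n)) = p * u1 (S n) + q * u1 n)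
  by (intros n; apply Hu).
assert (Hu2 : forall x, PSeries (egf_coef u2) x
          = p * PSeries (egf_coef u1) x + q * PSeries (egf_coef u) x).
{ intros x; rewrite <- !PSeries_scal, <- PSeries_plus
    by (apply (ex_pseries_scal (V := R_NormedModule));
        [apply Rmult_comm|now apply Hex]).
  apply PSeries_ext; intros n.
  unfold PS_plus, PS_scal, egf_coef, u2, u1; rewrite Hu.
  unfold plus, scal; simpl; unfold mult; simpl; field; apply INR_fact_neq_0. }
assert (HD : PSeries (egf_coef u) t - F t = 0).
{ apply (linear_ode_zero p q (fun x => PSeries (egf_coef u) x - F x)
           (fun x => PSeries (egf_coef u1) x - dF x)).
  - intros x; apply (is_derive_minus (V := R_NormedModule)); [now apply Hder|apply HF].
  - intros x.
    replace (p * (PSeries (egf_coef u1) x - dF x) +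
             q * (PSeries (egf_coef u) x - F x))
      with (PSeries (egf_coef u2) x - (p * dF x + q * F x))
      by (rewrite Hu2; ring).
    apply (is_derive_minus (V := R_NormedModule)); [now apply (Hder u1)|apply HdF].
  - rewrite PSeries_0, HF0; unfold egf_coef; simpl; field.
  - rewrite PSeries_0, HdF0; unfold egf_coef, u1; simpl; field. }
replace (F t) with (PSeries (egf_coef u) t) by lra.
apply is_series_ext with (fun n => egf_coef u n * t ^ n).
(* The equation lives in the carrier of a normed module; the ascription restates it in [R] for
   [field]. *)
- intros n; unfold egf_coef; apply (eq_sym (y := _ : R)).
  field; apply INR_fact_neq_0.
- apply is_pseries_R, PSeries_correct; now apply Hex.
Qed.

Theorem proposition9 (z t : R) (hz : 1 / 4 <= z) :
  is_series (fun n : nat => g n z * (t ^ n / INR (fact n)))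
    (if Rlt_dec (1 / 4) z then
       exp (t / (2 * sqrt z)) *
       (cos (t * sqrt (4 * z - 1) / (2 * sqrt z)) +
        1 / sqrt (4 * z - 1) * sin (t * sqrt (4 * z - 1) / (2 * sqrt z)))
     else (t + 1) * exp t).
Proof.
assert (hz0 : 0 < z) by lra.
assert (Hs : 0 < sqrt z) by now apply sqrt_lt_R0.
assert (Hs2 : sqrt z * sqrt z = z) by (apply sqrt_sqrt; lra).
assert (Hg : forall n, g (S (S n)) z = / sqrt z * g (S n) z + -1 * g n z)
  by (intros n; rewrite g_SS by assumption; ring).
pose proof (g_1 z hz0) as Hg1.
destruct (Rlt_dec (1 / 4) z) as [Hz|Hz].
- assert (Hw : 0 < sqrt (4 * z - 1)) by (apply sqrt_lt_R0; lra).
  assert (Hw2 : sqrt (4 * z - 1) * sqrt (4 * z - 1) = 4 * z - 1)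
    by (apply sqrt_sqrt; lra).
  (* From here the square roots enter only through positivity and [w^2 = 4s^2 - 1]. *)
  set (s := sqrt z) in *; set (w := sqrt (4 * z - 1)) in *.
  assert (Hw2' : w * w = 4 * (s * s) - 1) by lra.
  clearbody s w.
  apply (is_series_egf (/ s) (-1) (fun n => g n z)
    (fun x => exp (x / (2 * s)) *
       (cos (x * w / (2 * s)) + 1 / w * sin (x * w / (2 * s))))
    (fun x => exp (x / (2 * s)) *
       (/ s * cos (x * w / (2 * s))
        + (1 / (2 * s * w) - w / (2 * s)) * sin (x * w / (2 * s))))).
  + exact Hg.
  + intros x; auto_derive; [lra|]; unfold Rdiv; field; lra.
  + intros x; auto_derive; [lra|].
    change (x * w * / (2 * s)) with (x * w / (2 * s)).
    change (x * / (2 * s)) with (x / (2 * s)).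
    set (ex := exp _); set (co := cos _); set (si := sin _).
    clearbody ex co si.
    field_simplify_eq; [|lra].
    (* The second-order equation holds only modulo the relation between [w] and [s]. *)
    replace (s ^ 2) with ((w * w + 1) / 4) by lra; field.
  + rewrite g_0 by assumption.
    unfold Rdiv; rewrite !Rmult_0_l, exp_0, cos_0, sin_0; ring.
  + rewrite Hg1.
    unfold Rdiv; rewrite !Rmult_0_l, exp_0, cos_0, sin_0; ring.
- assert (Hz' : z = 1 / 4) by lra.
  assert (Hs' : sqrt z = / 2).
  { rewrite Hz'; replace (1 / 4) with (/ 2 * / 2) by field.
    apply sqrt_square; lra. }
  (* Here [/ sqrt z = 2], and the characteristic polynomial [(X - 1)^2] has a double root, whence
     the linear factor. *)
  apply (is_series_egf 2 (-1) (fun n => g n z)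
    (fun x => (x + 1) * exp x) (fun x => (x + 2) * exp x)).
  + intros n; rewrite Hg, Hs'; field.
  + intros x; auto_derive; [exact I|ring].
  + intros x; auto_derive; [exact I|ring].
  + rewrite g_0, exp_0 by assumption; ring.
  + rewrite Hg1, exp_0, Hs' by assumption; field.
Qed.
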